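(* Let $\mathbb X$ and $\mathbb Y$ be Hilbert spaces, let $\mathbf A\colon \mathbb X\to\mathbb Y$ be a bounded linear operator, and let $\lambda\in(0,1/\|\mathbf A\|^2)$. Then for every exact data $y\in \mathbf A(\mathbb X)$ the Landweber iteration $$x_{k+1}=x_k-\lambda\,\mathbf A^*(\mathbf A x_k-y)$$ is bounded perturbation resilient with respect to the solution set $\{x\in\mathbb X \mid \mathbf A x=y\}$. That is, for all $x_0\in\mathbb X$, the perturbed Landweber iteration with exact data $$x_{k+1/2}=x_k+t_k\Phi_k(x_k),\qquad x_{k+1}=x_{k+1/2}-\lambda\,\mathbf A^*(\mathbf A x_{k+1/2}-y)\qquad (k\in\mathbb N)$$ converges to a solution of the equation $\mathbf A x=y$, where $(t_k)_{k\in\mathbb N}$ is any summable sequence of nonnegative numbers and $(\Phi_k)_{k\in\mathbb N}$ is any family of continuous mappings $\Phi_k\colon\mathbb X\to\mathbb X$ with $\sup_{k}\sup_{x\in\mathbb X}\|\Phi_k(x)\|<\infty$. In particular, for fixed such $(t_k)_{k}$ and $(\Phi_k)_{k}$, denoting by $\mathbf B_k(y)$ the $k$-th iterate $x_k$ of the perturbed Landweber iteration with data $y$ and initial value $x_0=0$, the limits of the iteration define a right inverse $$\mathbf B\colon \mathbf A(\mathbb X)\to\mathbb X,\qquad \mathbf B(y)=\lim_{k\to\infty}\mathbf B_k(y)$$ of $\mathbf A$.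
   Context: $\mathbf A^*$ denotes the adjoint of $\mathbf A$. Convergence is in the norm of $\mathbb X$. $\mathbb N$ is the set of natural numbers, including $0$ as the starting index of the iteration. A right inverse of $\mathbf A$ is any (possibly non-linear) mapping $\mathbf R\colon \mathbf A(\mathbb X)\to\mathbb X$ with $\mathbf A(\mathbf R(y))=y$ for all $y\in\mathbf A(\mathbb X)$. Bounded perturbation resilience: let $\mathbb S\subseteq\mathbb X$ and $\mathbf T\colon\mathbb X\to\mathbb X$, and suppose that for all initial values $x_0\in\mathbb X$ the basic iteration $x_{k+1}=\mathbf T(x_k)$ converges to some element of $\mathbb S$. The basic iteration is called bounded perturbation resilient with respect to $\mathbb S$ if for all $x_0\in\mathbb X$, all $(t_k)_{k\in\mathbb N}\in[0,\infty)^{\mathbb N}$ with $\sum_{k\in\mathbb N}t_k<\infty$ and all bounded sequences $(d_k)_{k\in\mathbb N}\in\mathbb X^{\mathbb N}$, the perturbed iteration $x_{k+1}=\mathbf T(x_k+t_kd_k)$ converges to some element of $\mathbb S$. For the Landweber iteration, $\mathbf T(x)=x-\lambda\mathbf A^*(\mathbf A x-y)$. *)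

(* Defs.v *)
From HB Require Import structures.
From mathcomp Require Import all_boot all_order all_algebra.
From mathcomp Require Import all_classical all_reals all_analysis.
From mathcomp Require Import complex.

Set Implicit Arguments.
Unset Strict Implicit.
Unset Printing Implicit Defensive.

Import Order.TTheory GRing.Theory Num.Theory.
Import numFieldNormedType.Exports.

Local Open Scope classical_set_scope.
Local Open Scope ring_scope.

(* The scalars K are either the reals or the complex numbers over R, and conj
   is the corresponding conjugation.  In the complex case norms are elements of
   R[i], and both [0 <= x] and [0 < x] entail that x is real. *)
Inductive hilbert_scalars (R : realType) :
    forall K : numFieldType, (K -> K) -> Prop :=
| real_scalars : @hilbert_scalars R R idfun
| complex_scalars : @hilbert_scalars R R[i] (@Num.conj R[i]).

(* The inner product is linear in its first argument and conj-linear in its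
   second one. *)
Record hilbertSpace (K : numFieldType) (conj : K -> K) := HilbertSpace {
  hilbert_sort :> completeNormedModType K;
  inner : {dot hilbert_sort for conj};
  inner_normE : forall x : hilbert_sort, `|x| ^+ 2 = inner x x }.

Section Operators.
Context {K : numFieldType} {conj : K -> K}.
Implicit Types X Y : hilbertSpace conj.

(* The supremum is taken for the order of K; the closed unit ball contains 0,
   hence the default value 0 of supremum is irrelevant for bounded A. *)
Definition opnorm X Y (A : X -> Y) : K :=
  supremum 0 [set `|A x| | x in [set x | `|x| <= 1]].

Definition is_adjoint X Y (A : X -> Y) (Aadj : Y -> X) : Prop :=
  forall (x : X) (y : Y), inner Y (A x) y = inner X x (Aadj y).

Definition landweber X Y (A : X -> Y) (Aadj : Y -> X) (lambda : K) (y : Y)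
    (x : X) : X :=
  x - lambda *: Aadj (A x - y).

Definition right_inverse_of X Y (A : X -> Y) (B : Y -> X) : Prop :=
  {in range A, cancel B A}.

End Operators.

Section Perturbations.
Context {K : numFieldType} {X : completeNormedModType K}.
Implicit Types (S : set X) (T : X -> X) (t : nat -> K) (d : nat -> X).

Definition cvg_into S (u : nat -> X) : Prop :=
  exists2 x, S x & u @ \oo --> x.

Definition summable_nneg t : Prop :=
  (forall k, 0 <= t k) /\ cvgn (series t).

Fixpoint perturbed_iter T t (Phi : nat -> X -> X) (x0 : X) (k : nat) : X :=
  if k is k'.+1 then
    let x := perturbed_iter T t Phi x0 k' in T (x + t k' *: Phi k' x)
  else x0.

Definition bounded_perturbation_resilient S T : Prop :=
  (forall x0, cvg_into S (fun k => iter k T x0)) /\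
  (forall x0 t d, summable_nneg t -> bounded_fun d ->
     cvg_into S (perturbed_iter T t (fun k _ => d k) x0)).

End Perturbations.

(* Main.v *)
Require Import Defs.
From HB Require Import structures.
From mathcomp Require Import all_boot all_order all_algebra.
From mathcomp Require Import all_classical all_reals all_analysis.
From mathcomp Require Import complex.
From mathcomp Require Import ring.

Set Implicit Arguments.
Unset Strict Implicit.
Unset Printing Implicit Defensive.

Import Order.TTheory GRing.Theory Num.Theory.
Import numFieldNormedType.Exports.

Local Open Scope classical_set_scope.
Local Open Scope ring_scope.

(** Resilience is a soft consequence of two facts about the Landweber step
    [T x = x - lambda A^*(A x - y)]: it is nonexpansive, and its unperturbed
    iterates converge from every starting point.

    Indeed, let [T] be any such map and let [x_k] be a perturbed orbit.  By
    nonexpansiveness, the unperturbed orbit started at [x_N] stays within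
    [M * \sum_(j >= N) t_j] of the perturbed one.  That orbit converges and the
    tail of the series vanishes, so [x_k] is a Cauchy sequence; its limit is a
    fixed point of [T] because [T] is continuous and the perturbations tend to
    0 ([perturbed_iter_cvg_fixpoint]).  A fixed point of the Landweber step
    solves the normal equation [A^*(A x - A z) = 0], hence, by pairing with
    [x - z], the equation [A x = A z] ([landweber_fixpoint]).

    For exact data [y = A z] the step is, up to the translation by [z], the
    self-adjoint operator [S = 1 - lambda A^*A], and [lambda |A|^2 <= 1] means
    that [0 <= S <= 1].  The moments [a_k = <S^k a, a>] are then nonincreasing
    in [k], and self-adjointness gives
      [|S^m a - S^n a|^2 = a_(2m) - 2 a_(m+n) + a_(2n) <= a_(2m) - a_(2n)]
    for [m <= n].  As [a_(2k) = |S^k a|^2] decreases and is bounded below, the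
    orbit is Cauchy ([iter_landweber0_cvg]).

    Real and complex scalars are treated at once.  Everything above takes place
    in a partially ordered field [K], and beyond its algebra it uses two
    features of [K] which both cases share: nonempty bounded sets of nonnegative
    scalars have least upper bounds ([nneg_supremums]), and conjugation fixes
    the nonnegative scalars ([conj_ge0_id]). *)

(** * Order completeness of the scalars *)

(** In the complex case nonnegative numbers, and all upper bounds of a nonempty
    set of them, are real, so the supremum of the real parts is the least upper
    bound for the partial order of [R[i]]. *)
Lemma nneg_supremums (R : realType) (K : numFieldType) (conj : K -> K) :
  @hilbert_scalars R K conj -> forall E : set K, E !=set0 ->
  (forall x, E x -> 0 <= x) -> ubound E !=set0 -> supremums E !=set0.
Proof.
case=> E [x0 Ex0] E0 [b ubE].
  have hsE : has_sup E by split; [exists x0|exists b].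
  exists (sup E); split; first exact: ub_le_sup hsE.2.
  by move=> z zE; apply: ge_sup => //; exists x0.
have ImE x : E x -> complex.Im x = 0 by move=> /E0; exact: ger0_Im.
have hsRE : has_sup (@complex.Re R @` E).
  split; first by exists (complex.Re x0), x0.
  exists (complex.Re b) => _ [x Ex <-].
  by have := ubE x Ex; rewrite lecE => /andP[].
exists (sup (@complex.Re R @` E))%:C%C; split => [x Ex|z zE]; rewrite lecE /=.
  by rewrite ImE// eqxx /= (ub_le_sup hsRE.2) //; exists x.
have Imz : complex.Im z = 0.
  by apply: ger0_Im; apply: le_trans (E0 _ Ex0) (zE _ Ex0).
rewrite Imz eqxx /=; apply: ge_sup; first exact: hsRE.1.
by move=> _ [x Ex <-]; have := zE x Ex; rewrite lecE => /andP[].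
Qed.

Lemma conj_ge0_id (R : realType) (K : numFieldType) (conj : K -> K) :
  @hilbert_scalars R K conj -> forall x, 0 <= x -> conj x = x.
Proof. by case=> // x x0; exact: geC0_conj. Qed.

(** The total decrease [u 0 - u n] has a least upper bound over [n], which is
    almost attained at some [N]; beyond [N] little decrease remains. *)
Lemma nonincreasing_nneg_gap (R : realType) (K : numFieldType)
    (conj : K -> K) (u : nat -> K) (e : K) :
  @hilbert_scalars R K conj -> (forall n, 0 <= u n) ->
  {homo u : m n / (m <= n)%N >-> n <= m} -> 0 < e ->
  exists N, forall n, (N <= n)%N -> u N - u n < e.
Proof.
move=> hK u0 u_dec e0; pose E := [set u 0%N - u n | n in setT].
have E0 : E 0 by exists 0%N; rewrite ?subrr.
have [||//|s [sE s_least]] := nneg_supremums hK (E := E).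
- by exists 0.
- by move=> _ [n _ <-]; rewrite subr_ge0 u_dec.
- by exists (u 0%N) => _ [n _ <-]; rewrite lerBlDr lerDl.
have /existsNP[_ /not_implyP[[N _ <-] sN]] : ~ ubound E (s - e).
  by move=> /s_least; rewrite lerBrDl gerDr => /(lt_le_trans e0); rewrite ltxx.
exists N => n Nn.
have {}sN : s - e < u 0%N - u N.
  rewrite real_ltNge ?realB ?(gtr0_real e0) ?ger0_real //; last by apply: sE.
  by apply/negP=> h; apply: sN.
have -> : u N - u n = (u 0%N - u n) - (u 0%N - u N) by ring.
rewrite ltrBlDr -ltrBlDl; apply: le_lt_trans sN.
by rewrite lerD2r; apply: sE; exists n.
Qed.

(** * Perturbations of nonexpansive maps *)

(** Since [T] is nonexpansive, it never amplifies the perturbations, so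
    restarting the unperturbed iteration at a late index [N] makes an error of
    at most the tail of the series [M * t].  Convergence of all unperturbed
    orbits is therefore inherited by the perturbed ones. *)
Lemma perturbed_iter_cvg_fixpoint (K : numFieldType)
    (X : completeNormedModType K) (T : X -> X) (t : nat -> K)
    (Phi : nat -> X -> X) (M : K) (x0 : X) :
  (forall a b, `|T a - T b| <= `|a - b|) ->
  (forall x, cvgn (fun k => iter k T x)) ->
  summable_nneg t -> (forall k x, `|Phi k x| <= M) ->
  cvg_into [set x | T x = x] (perturbed_iter T t Phi x0).
Proof.
move=> T1 Tcvg [t0 tcvg] PhiM; set x := perturbed_iter T t Phi x0.
have M0 : 0 <= M by apply: le_trans (PhiM 0%N x0).
have step n a : `|T a - x n.+1| <= `|a - x n| + M * t n.
  rewrite (le_trans (T1 _ _)) // opprD addrA (le_trans (ler_normB _ _)) //.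
  by rewrite lerD2l normrZ ger0_norm // mulrC ler_wpM2r.
have track N k :
    `|iter k T (x N) - x (N + k)%N| <= M * \sum_(N <= j < N + k) t j.
  elim: k => [|k IH]; first by rewrite addn0 subrr normr0 big_geq ?mulr0.
  rewrite addnS iterS (le_trans (step _ _)) //.
  by rewrite big_nat_recr ?leq_addr //= mulrDr lerD2r.
have xcvg : cvgn x.
  apply/cauchy_cvgP/cauchy_exP => e e0.
  (* [M] may vanish, hence the division by [M + 1]. *)
  have M1 : 0 < M + 1 by rewrite ltr_wpDl.
  have d0 : 0 < e / 2 / (M + 1) by rewrite !divr_gt0.
  have /cvg_cauchy/(@cauchy_seriesP _ K^o)/(_ _ d0) := tcvg.
  case=> -[P Q] /= [[N1 _ PN] [N2 _ QN]] PQ.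
  pose N := maxn N1 N2.
  have tail k : M * \sum_(N <= j < N + k) t j < e / 2.
    have := PQ (N, (N + k)%N); rewrite /= ger0_norm ?sumr_ge0 // => -/(_ _) h.
    apply: (@le_lt_trans _ _ ((M + 1) * \sum_(N <= j < N + k) t j)).
      by rewrite ler_wpM2r ?sumr_ge0 // lerDl.
    rewrite mulrC -ltr_pdivlMr // h //; split; [apply: PN|apply: QN] => /=.
      by rewrite leq_maxl.
    by rewrite (leq_trans (leq_maxr N1 N2)) ?leq_addr.
  have e20 : 0 < e / 2 by rewrite divr_gt0.
  have /cvgrPdist_lt/(_ _ e20) [N' _ hN'] := Tcvg (x N).
  (* The limit of the unperturbed orbit of [x N] is a centre of a ball of
     radius [e] which eventually contains the perturbed orbit. *)
  exists (lim (iter k T (x N) @[k --> \oo])).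
  exists (N + N')%N => // n /= Nn; rewrite -ball_normE /ball_ /=.
  have Nn' : (N <= n)%N by rewrite (leq_trans _ Nn) ?leq_addr.
  rewrite (splitr e) -(subnKC Nn').
  rewrite (le_lt_trans (ler_distD (iter (n - N) T (x N)) _ _)) // ltrD //.
    by apply: hN'; rewrite /= leq_subRL.
  by rewrite (le_lt_trans (track _ _)).
exists (limn x); last exact: xcvg.
rewrite /=; set l := limn x.
have xSl : x n.+1 @[n --> \oo] --> l.
  by rewrite (cvg_shiftS x).
have tcvg0 : t n @[n --> \oo] --> 0 by exact: cvg_series_cvg_0.
suff : x n.+1 @[n --> \oo] --> T l.
  by move=> h; apply: (cvg_unique (@norm_hausdorff _ _)) xSl.
apply/cvgrPdist_lt => e e0.
have bound : `|l - x n| + M * t n @[n --> \oo] --> (0 : K).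
  rewrite -[X in _ --> X](_ : `|l - l| + M * 0 = 0); last first.
    by rewrite subrr normr0 mulr0 addr0.
  apply: cvgD; last exact: cvgMr.
  by apply: cvg_norm; apply: cvgB => //; exact: cvg_cst.
have /cvgrPdist_lt/(_ _ e0) := bound; apply: filterS => n.
rewrite sub0r normrN ger0_norm; last by rewrite addr_ge0 // mulr_ge0.
exact: le_lt_trans.
Qed.

(** * Inner products *)

Section InnerProduct.
Context {K : numFieldType} {conj : K -> K} {X : hilbertSpace conj}.
Hypothesis conj_id : forall r : K, 0 <= r -> conj r = r.
Implicit Types (a b c : X) (r : K).

Lemma innerC a b : inner X a b = conj (inner X b a).
Proof. by rewrite [LHS](@hermitian_subproof _ _ _ _ (inner X)) expr0 mul1r. Qed.

Lemma innerBl a b c : inner X (a - b) c = inner X a c - inner X b c.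
Proof. exact: linearBl. Qed.

Lemma innerBr a b c : inner X c (a - b) = inner X c a - inner X c b.
Proof. exact: linearBr. Qed.

Lemma innerZl r a b : inner X (r *: a) b = r * inner X a b.
Proof. exact: (linearZl_LR (inner X)). Qed.

(** The second argument is conjugate-linear, but conjugation fixes nonnegative
    factors such as the step size. *)
Lemma innerZr r a b : 0 <= r -> inner X a (r *: b) = r * inner X a b.
Proof. by move=> r0; rewrite [LHS](linearZr_LR (inner X)) /= conj_id. Qed.

Lemma inner_eq0 a : (forall b, inner X b a = 0) -> a = 0.
Proof.
by move=> a0; apply/normr0_eq0/eqP; rewrite -sqrf_eq0 inner_normE a0.
Qed.

Lemma sqr_normBZ r a b : 0 <= r ->
  `|a - r *: b| ^+ 2 =
  `|a| ^+ 2 - r * (inner X a b + inner X b a) + r ^+ 2 * `|b| ^+ 2.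
Proof.
move=> r0; rewrite !inner_normE innerBl !innerBr !innerZl !innerZr //.
by ring.
Qed.

End InnerProduct.

(** * The Landweber step *)

Section Landweber.
Context {R : realType} {K : numFieldType} {conj : K -> K}.
Context {X Y : hilbertSpace conj}.
Hypothesis hK : @hilbert_scalars R K conj.
Variables (A : {linear X -> Y}) (Aadj : Y -> X) (lambda : K).
Hypothesis AadjP : is_adjoint A Aadj.
Hypothesis lambda0 : 0 < lambda.
Hypothesis lambdaA : forall x, lambda * `|A x| ^+ 2 <= `|x| ^+ 2.
Implicit Types (a b x : X) (y : Y).

Let conj_id := conj_ge0_id hK.

Local Notation gram a := (Aadj (A a)).
(* With zero data the step is the linear operator [1 - lambda A^*A], the
   linear part of the step for arbitrary data. *)
Local Notation S := (landweber A Aadj lambda 0).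

(** The adjoint is given as a bare function; its additivity follows from the
    uniqueness of the vector representing a functional. *)
Lemma adjointB y y' : Aadj (y - y') = Aadj y - Aadj y'.
Proof.
apply/eqP; rewrite -subr_eq0; apply/eqP/inner_eq0 => x.
by rewrite !innerBr -!AadjP innerBr subrr.
Qed.

Lemma landweber0E a : S a = a - lambda *: gram a.
Proof. by rewrite /landweber subr0. Qed.

Lemma landweberB y a b :
  landweber A Aadj lambda y a - landweber A Aadj lambda y b = S (a - b).
Proof.
rewrite landweber0E /landweber opprD addrACA -opprD -scalerBr -adjointB.
by rewrite opprB addrA subrK linearB.
Qed.

Lemma inner_gramr a b : inner X a (gram b) = inner Y (A a) (A b).
Proof. by rewrite AadjP. Qed.

Lemma inner_graml a b : inner X (gram a) b = inner Y (A a) (A b).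
Proof. by rewrite innerC -AadjP -innerC. Qed.

(** This is [lambda * |A^*|^2 <= 1] on the range of [A].  Expanding
    [0 <= |A a - lambda A g|^2] with [g = A^*A a] gives
    [2 lambda |g|^2 <= |A a|^2 + lambda^2 |A g|^2], and the bound on [A] at [g]
    absorbs the last term. *)
Lemma gram_bound a : lambda * `|gram a| ^+ 2 <= `|A a| ^+ 2.
Proof.
have l0 := ltW lambda0; set g := gram a.
have : 0 <= `|A a - lambda *: A g| ^+ 2 by rewrite exprn_ge0.
rewrite sqr_normBZ // -inner_graml -inner_gramr -!inner_normE => h.
have := ler_wpM2l l0 (lambdaA g); rewrite -subr_ge0 => /(addr_ge0 h) h'.
by rewrite -subr_ge0; apply: etrans h'; congr (0 <= _); ring.
Qed.

Lemma landweber0_sqr_norm a :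
  `|S a| ^+ 2 <= `|a| ^+ 2 - lambda * `|A a| ^+ 2.
Proof.
rewrite landweber0E sqr_normBZ ?(ltW lambda0) //.
rewrite inner_graml inner_gramr -inner_normE.
have := ler_wpM2l (ltW lambda0) (gram_bound a); rewrite -subr_ge0 => h.
by rewrite -subr_ge0; apply: etrans h; congr (0 <= _); ring.
Qed.

Lemma landweber_nonexpansive y a b :
  `|landweber A Aadj lambda y a - landweber A Aadj lambda y b| <= `|a - b|.
Proof.
rewrite landweberB -(@ler_pXn2r _ 2) ?nnegrE //.
rewrite (le_trans (landweber0_sqr_norm _)) // gerBl mulr_ge0 ?exprn_ge0 //.
exact: ltW.
Qed.

Lemma landweber0_self_adjoint a b : inner X (S a) b = inner X a (S b).
Proof.
rewrite !landweber0E innerBl innerBr innerZl innerZr ?(ltW lambda0) //.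
by rewrite inner_graml inner_gramr.
Qed.

Lemma inner_iter_landweber0 m n a :
  inner X (iter m S a) (iter n S a) = inner X (iter (m + n) S a) a.
Proof.
elim: n m => [|n IH] m; first by rewrite addn0.
by rewrite iterS -landweber0_self_adjoint -iterS IH addSnnS.
Qed.

(** The operator inequality [S <= 1]. *)
Lemma inner_landweber0_le a : inner X (S a) a <= inner X a a.
Proof.
rewrite landweber0E innerBl innerZl inner_graml -!inner_normE gerBl.
by rewrite mulr_ge0 ?exprn_ge0 // ltW.
Qed.

(** The operator inequality [S^2 <= S]: the difference is
    [lambda (|A a|^2 - lambda |A^*A a|^2)]. *)
Lemma inner_landweber0_ge a : inner X (S a) (S a) <= inner X (S a) a.
Proof.
rewrite -subr_ge0 -innerBr.
have -> : a - S a = lambda *: gram a by rewrite landweber0E opprB addrC subrK.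
rewrite innerZr ?(ltW lambda0) // mulr_ge0 ?(ltW lambda0) //.
rewrite landweber0E innerBl innerZl.
by rewrite inner_gramr -!inner_normE subr_ge0 gram_bound.
Qed.

(** Splitting [S^k] evenly between the two arguments reduces the step from [k]
    to [k + 1] to [S <= 1] for even [k] and to [S^2 <= S] for odd [k]. *)
Lemma inner_iter_landweber0_homo a :
  {homo (fun k => inner X (iter k S a) a) : m n / (m <= n)%N >-> n <= m}.
Proof.
apply/nonincreasing_seqP => k; rewrite -(odd_double_half k).
set b := iter k./2 S a.
have even : inner X (iter k./2.*2 S a) a = inner X b b.
  by rewrite inner_iter_landweber0 addnn.
have oddE : inner X (iter k./2.*2.+1 S a) a = inner X (S b) b.
  by rewrite -addnn -addSn -inner_iter_landweber0.
case: (odd k); rewrite ?add0n ?add1n.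
  rewrite oddE -addnn -addnS -addSn -inner_iter_landweber0.
  exact: inner_landweber0_ge.
by rewrite oddE even inner_landweber0_le.
Qed.

(** The cross term of the expanded square is the moment of order [m + n], which
    dominates the moment of order [n + n]. *)
Lemma sqr_dist_iter_landweber0 m n a : (m <= n)%N ->
  `|iter m S a - iter n S a| ^+ 2 <=
  `|iter m S a| ^+ 2 - `|iter n S a| ^+ 2.
Proof.
move=> mn; rewrite !inner_normE innerBl !innerBr !inner_iter_landweber0.
have h : inner X (iter (n + n) S a) a <= inner X (iter (m + n) S a) a.
  by apply: inner_iter_landweber0_homo; rewrite leq_add2r.
rewrite [(n + m)%N]addnC (@le_trans _ _ _ _ _ _ (lerB (lexx _) h)) //.
by rewrite gerBl subr_ge0.
Qed.

Lemma iter_landweber0_cvg a :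
  cvgn (fun k => iter k S a).
Proof.
apply/cauchy_cvgP/cauchy_exP => e e0.
have [||| N hN] := nonincreasing_nneg_gap
  (u := fun k => `|iter k S a| ^+ 2) (e := e ^+ 2) hK.
- by move=> n; rewrite exprn_ge0.
- move=> m n mn /=; rewrite !inner_normE !inner_iter_landweber0.
  by apply: inner_iter_landweber0_homo; rewrite leq_add.
- by rewrite exprn_gt0.
exists (iter N S a); exists N => // n /= Nn; rewrite -ball_normE /ball_ /=.
rewrite -(@ltr_pXn2r _ 2) ?nnegrE // ?(ltW e0) //.
by rewrite (le_lt_trans (sqr_dist_iter_landweber0 _ Nn)) // hN.
Qed.

Lemma iter_landweberE a z k :
  iter k (landweber A Aadj lambda (A z)) a = z + iter k S (a - z).
Proof.
elim: k => [|k IH] /=; first by rewrite addrC subrK.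
have Tz : landweber A Aadj lambda (A z) z = z.
  by rewrite /landweber adjointB subrr scaler0 subr0.
rewrite IH; set w := iter k S (a - z).
have -> : S w = landweber A Aadj lambda (A z) (z + w) - z.
  by rewrite -[X in _ - X]Tz landweberB addrAC subrr add0r.
by rewrite [RHS]addrC subrK.
Qed.

Lemma iter_landweber_cvg a z :
  cvgn (fun k => iter k (landweber A Aadj lambda (A z)) a).
Proof.
under eq_fun do rewrite iter_landweberE.
by apply: is_cvgD; [exact: is_cvg_cst|exact: iter_landweber0_cvg].
Qed.

(** For [w = x - z], a fixed point gives [A^*A w = 0], so
    [|A w|^2 = <w, A^*A w> = 0]. *)
Lemma landweber_fixpoint x z :
  landweber A Aadj lambda (A z) x = x -> A x = A z.
Proof.
move=> /eqP; rewrite /landweber -subr_eq0 addrAC subrr add0r oppr_eq0.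
rewrite scaler_eq0 gt_eqF //= -linearB => /eqP Axz; apply/eqP.
rewrite -subr_eq0 -linearB -normr_eq0 -sqrf_eq0 inner_normE -inner_gramr Axz.
by rewrite [inner _ _ _](linear0r (inner X)).
Qed.

Lemma perturbed_landweber_cvg (t : nat -> K) (Phi : nat -> X -> X) (M : K)
    x0 y :
  range A y ->
  summable_nneg t -> (forall k x, `|Phi k x| <= M) ->
  cvg_into [set x | A x = y]
    (perturbed_iter (landweber A Aadj lambda y) t Phi x0).
Proof.
move=> [z _ <-] ht PhiM.
have [x Tx xcvg] := perturbed_iter_cvg_fixpoint x0
  (landweber_nonexpansive (A z)) (fun a => @iter_landweber_cvg a z) ht PhiM.
by exists x => //; exact: landweber_fixpoint.
Qed.

End Landweber.

(** * The step size condition *)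

(** The supremum defining [opnorm A] takes its default value 0 unless a least
    upper bound exists; boundedness of [A] is what rules this out. *)
Lemma opnorm_bound (R : realType) (K : numFieldType) (conj : K -> K)
    (X Y : hilbertSpace conj) (A : {linear X -> Y}) :
  @hilbert_scalars R K conj -> bounded_near A (nbhs (0 : X)) ->
  forall x, `|A x| <= opnorm A * `|x|.
Proof.
move=> hK /linear_boundedP Abnd x.
have unitP z : `|z| <= 1 -> `|A z| <= opnorm A.
  move=> z1; rewrite /opnorm; set E := [set `|A w| | w in _].
  have EAz : E `|A z| by exists z.
  have supE : supremums E !=set0.
    apply: (nneg_supremums hK); first by exists `|A z|.
      by move=> _ [w _ <-].
    have [M M0 AM] := pinfty_ex_gt0 Abnd; exists M => _ [w w1 <-].
    by rewrite (le_trans (AM w)) // ger_pMr.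
  rewrite /supremum ifN; last by apply/set0P; exists `|A z|.
  by have [ubE _] := xgetPex 0 supE; exact: ubE.
have [->|x0] := eqVneq x 0; first by rewrite linear0 !normr0 mulr0.
have nx : 0 < `|x| by rewrite normr_gt0.
rewrite -ler_pdivrMr // mulrC -[_^-1]ger0_norm ?invr_ge0 // -normrZ -linearZ.
by apply: unitP; rewrite normrZ normfV normr_id mulVf ?gt_eqF.
Qed.

Lemma step_size_bound (R : realType) (K : numFieldType) (conj : K -> K)
    (X Y : hilbertSpace conj) (A : {linear X -> Y}) (lambda : K) :
  @hilbert_scalars R K conj -> bounded_near A (nbhs (0 : X)) ->
  0 < lambda -> lambda * opnorm A ^+ 2 < 1 ->
  forall x, lambda * `|A x| ^+ 2 <= `|x| ^+ 2.
Proof.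
move=> hK hA l0 l1 x.
have Ax : `|A x| ^+ 2 <= (opnorm A * `|x|) ^+ 2.
  by apply: lerXn2r; rewrite ?nnegrE ?(opnorm_bound hK hA) //
    (le_trans _ (opnorm_bound hK hA x)).
rewrite (le_trans (ler_wpM2l (ltW l0) Ax)) // exprMn mulrA.
by rewrite ler_piMl ?exprn_ge0 // ltW.
Qed.

(** * Bounded perturbation resilience *)

Theorem theorem3p1 (R : realType) (K : numFieldType) (conj : K -> K)
    (hK : @hilbert_scalars R K conj) (X Y : hilbertSpace conj)
    (A : {linear X -> Y}) (hA : bounded_near A (nbhs (0 : X)))
    (Aadj : Y -> X) (hAadj : is_adjoint A Aadj)
    (lambda : K) (hlambda0 : 0 < lambda)
    (hlambda1 : lambda * opnorm A ^+ 2 < 1) :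
  (forall y : Y, range A y ->
     bounded_perturbation_resilient [set x : X | A x = y]
       (landweber A Aadj lambda y))
  /\
  (forall (t : nat -> K) (Phi : nat -> X -> X),
     summable_nneg t ->
     (forall k, continuous (Phi k)) ->
     (exists M : K, forall (k : nat) (x : X), `|Phi k x| <= M) ->
     (forall (y : Y) (x0 : X), range A y ->
        cvg_into [set x : X | A x = y]
          (perturbed_iter (landweber A Aadj lambda y) t Phi x0))
     /\
     (let Bk (k : nat) (y : Y) : X :=
        perturbed_iter (landweber A Aadj lambda y) t Phi 0 k in
      let B (y : Y) : X := limn (Bk ^~ y) in
      (forall y : Y, range A y -> Bk ^~ y @ \oo --> B y)
      /\ right_inverse_of A B)).
Proof.
have lambdaA := step_size_bound hK hA hlambda0 hlambda1.
have solP := perturbed_landweber_cvg hK hAadj hlambda0 lambdaA.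
split=> [y yA|t Phi ht _ [M PhiM]].
  split=> [x0|x0 t d ht /pinfty_ex_gt0[M _ dM]].
    (* The basic iteration is the perturbed one with zero perturbations. *)
    have ht0 : summable_nneg (fun=> 0 : K).
      split=> //; suff -> : series (fun=> 0 : K) = fun=> 0.
        exact: is_cvg_cst.
      by apply/funext => n; rewrite /series /= big1.
    have := solP (fun=> 0) (fun _ _ => 0) 0 x0 y yA ht0.
    case=> [k x|x Ax xcvg]; first by rewrite normr0.
    exists x => //; move: xcvg; congr (_ @ \oo --> x); apply/funext.
    by elim=> //= k ->; rewrite scale0r addr0.
  by apply: (solP) => // k x; exact: (dM k).
have PhiP y x0 : range A y -> cvg_into [set x : X | A x = y]
    (perturbed_iter (landweber A Aadj lambda y) t Phi x0).
  by move=> yA; exact: (solP t Phi M).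
split=> [y x0|Bk B]; first exact: PhiP.
split=> [y /(PhiP y 0)[x _ xcvg]|y]; first exact: cvgP xcvg.
rewrite inE => /(PhiP y 0)[x Ax xcvg].
by rewrite /B (cvg_lim (@norm_hausdorff _ _) xcvg).
Qed.
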